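(* Let $(E,d)$ be a complete geodesic space with no bifurcating geodesics and the geodesic extension property. Suppose $A\in P_{cp}(E)$. Then the set \[\mathcal{W}_{max}=\left\{X\in P_{cp}(E) : \max(A,X)\text{ is well-posed}\right\}\] is a dense $G_\delta$-set in $P_{cp}(E)$ (with respect to the Pompeiu-Hausdorff distance).
   Context: Let $(E,d)$ be a metric space. A geodesic path from $x$ to $y$ is a map $c:[0,l]\to E$ with $c(0)=x$, $c(l)=y$ and $d(c(t),c(t'))=|t-t'|$ for all $t,t'\in[0,l]$; its image is a geodesic segment joining $x$ and $y$. $E$ is a geodesic space if every two points are joined by a geodesic path. A geodesic in $E$ is (the image of) a distance-preserving map from $\mathbb{R}$ into $E$. $E$ has the geodesic extension property if each geodesic segment is contained in a geodesic. A space is without bifurcating geodesics if for any two geodesic segments with the same initial point and having another common point (different from the initial one), this second point is a common endpoint of both or one segment contains the other. $P_{cp}(E)$ is the family of nonempty compact subsets of $E$, with the Pompeiu-Hausdorff distance $h(X,Y)=\max\{\sup_{x\in X}\mathrm{dist}(x,Y),\sup_{y\in Y}\mathrm{dist}(y,X)\}$, where $\mathrm{dist}(z,X)=\inf_{x\in X}d(z,x)$. For nonempty, bounded, closed sets $X,Y$ put $\mu_{XY}=\sup\{d(x,y):x\in X,y\in Y\}$. The problem $\max(X,Y)$ consists in finding $(x_0,y_0)\in X\times Y$ (a solution) with $d(x_0,y_0)=\mu_{XY}$. A maximizing sequence is a sequence $(x_n,y_n)$ in $X\times Y$ with $d(x_n,y_n)\to\mu_{XY}$. The problem $\max(X,Y)$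 is well-posed if it has a unique solution $(x_0,y_0)$ and every maximizing sequence $(x_n,y_n)$ satisfies $x_n\to x_0$ and $y_n\to y_0$. *)

(* Defs.v *)
From HB Require Import structures.
From mathcomp Require Import all_boot all_order all_algebra.
From mathcomp Require Import boolp classical_sets functions set_interval.
From mathcomp Require Import mathcomp_extra reals topology normedtype.
From mathcomp Require Import borel_hierarchy.

Set Implicit Arguments.
Unset Strict Implicit.
Unset Printing Implicit Defensive.

Import Order.TTheory GRing.Theory Num.Theory.
Import numFieldNormedType.Exports.

Local Open Scope classical_set_scope.
Local Open Scope ring_scope.

Section Geodesics.
Context {R : realType} (E : metricType R).

(* The library's [completeType] carries a base point and has no join with
   [metricType]; completeness is therefore stated as a predicate. *)
Definition complete_metric :=
  forall u : nat -> E, cauchy (u @ \oo) -> exists x : E, u @ \oo --> x.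

(* A path [0, l] -> E is a total map R -> E of which only the restriction to
   [0, l] matters; the degenerate case l = 0 is allowed. *)
Definition geodesic_path (x y : E) (l : R) (c : R -> E) :=
  [/\ 0 <= l, c 0 = x, c l = y
    & forall t t', `[0, l]%classic t -> `[0, l]%classic t' ->
        mdist (c t) (c t') = `|t - t'|].

Definition geodesic_segment (x y : E) (S : set E) :=
  exists l c, geodesic_path x y l c /\ S = c @` `[0, l]%classic.

Definition geodesic (L : set E) :=
  exists2 g : R -> E, (forall t t', mdist (g t) (g t') = `|t - t'|)
                    & L = range g.

Definition geodesic_space := forall x y : E, exists l c, geodesic_path x y l c.

Definition geodesic_extension_property :=
  forall x y S, geodesic_segment x y S -> exists2 L, geodesic L & S `<=` L.

Definition no_bifurcating_geodesics :=
  forall x y1 y2 S1 S2, geodesic_segment x y1 S1 -> geodesic_segment x y2 S2 ->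
  forall z, z <> x -> S1 z -> S2 z ->
    (z = y1 /\ z = y2) \/ S1 `<=` S2 \/ S2 `<=` S1.

End Geodesics.

Section MaxProblem.
Context {R : realType} {E : metricType R}.
Implicit Types X Y : set E.

(* The real-valued [sup] and [inf] below are 0 on sets without a supremum or
   infimum; this does not arise for the nonempty compact sets considered. *)
Definition mu X Y : R := sup [set mdist z.1 z.2 | z in X `*` Y].

Definition max_solution X Y (z : E * E) :=
  (X `*` Y) z /\ mdist z.1 z.2 = mu X Y.

Definition maximizing_sequence X Y (z : nat -> E * E) :=
  (forall n, (X `*` Y) (z n)) /\
  (mdist (z n).1 (z n).2 @[n --> \oo] --> mu X Y).

Definition max_well_posed X Y :=
  exists z0 : E * E,
    [/\ max_solution X Y z0,
        forall z, max_solution X Y z -> z = z0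
      & forall z, maximizing_sequence X Y z ->
          ((z n).1 @[n --> \oo] --> z0.1) /\ ((z n).2 @[n --> \oo] --> z0.2)].

End MaxProblem.

Section PompeiuHausdorff.
Context {R : realType} {E : metricType R}.
Implicit Types X Y : set E.

Definition dist (z : E) X : R := inf [set mdist z x | x in X].

Definition hausdorff_dist X Y : R :=
  Num.max (sup [set dist x Y | x in X]) (sup [set dist y X | y in Y]).

Lemma mdist_continuous (z : E) : continuous (fun x : E => mdist z x : R).
Proof.
move=> x; apply/cvgrPdist_le => e e0.
apply/metricType_numDomainType.nbhs_mdistP.
exists e => // y /= /ltW xy; rewrite (le_trans _ xy)//.
have h1 := metric_triangle z y x; have h2 := metric_triangle z x y.
rewrite (metric_sym y x) in h1.
by rewrite ler_norml lerBlDr lerBrDr addrC lerBlDr h2 addrC h1.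
Qed.

Lemma compact_mdist_bounded (z : E) X : compact X ->
  has_ubound [set mdist z x | x in X].
Proof.
move=> cX.
have : compact (mdist z @` X).
  apply: continuous_compact => //.
  by apply: continuous_subspaceT; exact: mdist_continuous.
move=> /(@compact_bounded R R)[M [_ HM]].
exists (M + 1) => _ [x Xx <-]; apply: le_trans (ler_norm _) _.
by apply: HM; [rewrite ltrDl|exists x].
Qed.

Lemma dist_le (z x : E) X : X x -> dist z X <= mdist z x.
Proof.
move=> Xx; apply: ge_inf; last by exists x.
by exists 0 => _ [y _ <-]; exact: mdist_ge0.
Qed.

Lemma dist_ge (z : E) X (r : R) : X !=set0 ->
  (forall x, X x -> r <= mdist z x) -> r <= dist z X.
Proof.
move=> [a Xa] H; apply: lb_le_inf; first by exists (mdist z a), a.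
by move=> _ [x Xx <-]; exact: H.
Qed.

Lemma dist_ge0 (z : E) X : X !=set0 -> 0 <= dist z X.
Proof. by move=> X0; apply: dist_ge => // x _; exact: mdist_ge0. Qed.

Lemma dist_le_sup X Y (x : E) : compact X -> Y !=set0 -> X x ->
  dist x Y <= sup [set dist x Y | x in X].
Proof.
move=> cX [y Yy] Xx; apply: ub_le_sup; last by exists x.
have [M HM] := compact_mdist_bounded y cX.
exists M => _ [t Xt <-]; apply: le_trans (dist_le t Yy) _.
by rewrite metric_sym; apply: HM; exists t.
Qed.

Lemma sup_dist_le X Y (r : R) : X !=set0 ->
  (forall x, X x -> dist x Y <= r) -> sup [set dist x Y | x in X] <= r.
Proof.
move=> [x Xx] H; apply: ge_sup; first by exists (dist x Y), x.
by move=> _ [t Xt <-]; exact: H.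
Qed.

Lemma sup_dist_triangle X Y Z : compact X -> compact Y -> X !=set0 ->
  Y !=set0 -> Z !=set0 ->
  sup [set dist x Z | x in X]
    <= sup [set dist x Y | x in X] + sup [set dist y Z | y in Y].
Proof.
move=> cX cY X0 Y0 Z0; apply: sup_dist_le => // x Xx.
apply: le_trans (lerD (dist_le_sup cX Y0 Xx) (lexx _)).
rewrite -lerBlDr; apply: dist_ge => // y Yy; rewrite lerBlDr.
apply: le_trans (lerD (lexx _) (dist_le_sup cY Z0 Yy)).
rewrite -lerBlDl; apply: dist_ge => // z Zz; rewrite lerBlDl.
by apply: le_trans (metric_triangle x y z); exact: dist_le.
Qed.

Lemma sup_dist0_subset X Y : compact X -> compact Y -> Y !=set0 ->
  sup [set dist x Y | x in X] <= 0 -> X `<=` Y.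
Proof.
move=> cX cY Y0 s0 x Xx.
have cY' : closed Y by apply: compact_closed => //; exact: metric_hausdorff.
apply: cY' => B; rewrite -metricType_numDomainType.filter_from_mdist_nbhs.
move=> [e /= e0 eB].
have dx : dist x Y <= 0 by apply: le_trans s0; exact: dist_le_sup.
have : has_inf [set mdist x y | y in Y].
  split; first by case: Y0 => y Yy; exists (mdist x y), y.
  by exists 0 => _ [y _ <-]; exact: mdist_ge0.
move=> /(inf_adherent e0) [_ [y Yy <-] ylt].
exists y; split => //; apply: eB; apply: lt_le_trans ylt _.
by rewrite gerDr.
Qed.

End PompeiuHausdorff.

Record Pcp {R : realType} (E : metricType R) := MkPcp {
  Pcp_set :> set E;
  Pcp_nonempty : Pcp_set !=set0;
  Pcp_compact : compact Pcp_set }.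
Arguments Pcp_nonempty {R E} _.
Arguments Pcp_compact {R E} _.

Section PcpMetric.
Context {R : realType} {E : metricType R}.
Implicit Types X Y Z : Pcp E.

Lemma Pcp_inj X Y : X = Y :> set E -> X = Y.
Proof.
case: X Y => [X X0 cX] [Y Y0 cY] /= XY; rewrite -XY in Y0 cY *.
by rewrite (Prop_irrelevance X0 Y0) (Prop_irrelevance cX cY).
Qed.

Let h X Y : R := hausdorff_dist X Y.

Let hxx X : h X X = 0.
Proof.
have e0 x : Pcp_set X x -> dist x X = 0.
  move=> Xx; apply/eqP; rewrite eq_le dist_ge0 ?andbT; last first.
    exact: Pcp_nonempty.
  by apply: le_trans (dist_le x Xx) _; rewrite mdistxx.
rewrite /h /hausdorff_dist maxxx; apply/eqP; rewrite eq_le; apply/andP; split.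
  by apply: sup_dist_le (Pcp_nonempty X) _ => x /e0 ->.
have [x Xx] := Pcp_nonempty X.
rewrite -(e0 _ Xx).
exact: (dist_le_sup (Pcp_compact X) (Pcp_nonempty X) Xx).
Qed.

Let h_eq0 X Y : h X Y = 0 -> X = Y.
Proof.
move=> h0; apply/Pcp_inj/seteqP; split.
  apply: sup_dist0_subset; [exact: Pcp_compact..|exact: Pcp_nonempty|].
  by rewrite -h0 /h /hausdorff_dist le_max lexx.
apply: sup_dist0_subset; [exact: Pcp_compact..|exact: Pcp_nonempty|].
by rewrite -h0 /h /hausdorff_dist le_max lexx orbT.
Qed.

Let h_sym X Y : h X Y = h Y X.
Proof. by rewrite /h /hausdorff_dist maxC. Qed.

Let h_triangle Y X Z : h X Z <= h X Y + h Y Z.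
Proof.
have [X0 Y0 Z0] := And3 (Pcp_nonempty X) (Pcp_nonempty Y) (Pcp_nonempty Z).
have [cX cY cZ] := And3 (Pcp_compact X) (Pcp_compact Y) (Pcp_compact Z).
rewrite {1}/h /hausdorff_dist ge_max; apply/andP; split.
  apply: le_trans (sup_dist_triangle cX cY X0 Y0 Z0) _.
  by apply: lerD; rewrite /h /hausdorff_dist le_max lexx.
apply: le_trans (sup_dist_triangle cZ cY Z0 Y0 X0) _.
by rewrite addrC; apply: lerD; rewrite /h /hausdorff_dist le_max lexx orbT.
Qed.

HB.instance Definition _ := gen_eqMixin (Pcp E).
HB.instance Definition _ := gen_choiceMixin (Pcp E).
HB.instance Definition _ :=
  isMetric.Build R (Pcp E) hxx h_eq0 h_sym h_triangle.

Lemma Pcp_mdistE X Y : mdist X Y = hausdorff_dist X Y. Proof. by []. Qed.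

Definition Wmax (A : Pcp E) : set (Pcp E) :=
  [set X : Pcp E | max_well_posed A X].

End PcpMetric.

(* Main.v *)
Require Import Defs.
From HB Require Import structures.
From mathcomp Require Import all_boot all_order all_algebra.
From mathcomp Require Import boolp classical_sets functions set_interval.
From mathcomp Require Import mathcomp_extra reals topology normedtype.
From mathcomp Require Import borel_hierarchy.
From mathcomp Require Import derive lra.

(** Compactness makes well-posedness equivalent to uniqueness of the solution,
    and also to the following: for every [e > 0] the pairs realizing [mu A X] up
    to some [d > 0] are within [e] of each other.  The latter condition, for a
    fixed [e], holds in a neighborhood of each [X] of [Wmax A], whence [Wmax A]
    is the intersection over [e = 1 / n] of the interiors.  For density, let
    [(a0, x0)] solve the problem for [X], prolong the geodesic from [a0] to [x0]
    by [e] beyond [x0], up to [y], and add [y] to [X].  A solution of the new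
    problem must be some [(a, y)] with [x0] between [a] and [y]; the absence of
    bifurcations at [x0], seen from [y], forces [a = a0]. *)

Set Implicit Arguments.
Unset Strict Implicit.
Unset Printing Implicit Defensive.

Import Order.TTheory GRing.Theory Num.Theory.
Import numFieldNormedType.Exports.

Local Open Scope classical_set_scope.
Local Open Scope ring_scope.

(** * Concatenation, prolongation and non-bifurcation of geodesics *)

Section Geodesics.
Context {R : realType} {E : metricType R}.
Implicit Types (x y z w : E) (S : set E).

Lemma geodesic_path_dist x y l (c : R -> E) t t' : geodesic_path x y l c ->
  0 <= t -> t <= t' -> t' <= l -> mdist (c t) (c t') = t' - t.
Proof.
move=> [_ _ _ cl] t0 tt' t'l; rewrite cl/= ?in_itv/=; [|lra|lra].
by rewrite distrC ger0_norm// subr_ge0.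
Qed.

Lemma geodesic_path_length x y l (c : R -> E) :
  geodesic_path x y l c -> l = mdist x y.
Proof.
move=> xy; case: (xy) => l0 <- <- _.
by rewrite (geodesic_path_dist xy) ?subr0.
Qed.

(** The parameter of a point on the path is its distance from the initial point. *)
Lemma geodesic_segment_dist_inj x y S z w :
  geodesic_segment x y S -> S z -> S w -> mdist x z = mdist x w -> z = w.
Proof.
move=> [l [c [[l0 <- _ cl] ->]]] [t /= tl <-] [s /= sl <-].
have l0l : 0 \in `[0, l] by rewrite in_itv/= lexx l0.
rewrite !cl//= !sub0r !normrN.
move: tl sl; rewrite !in_itv/= => /andP[t0 _] /andP[s0 _].
by rewrite !ger0_norm// => ->.
Qed.

Lemma geodesic_segment_right x y S : geodesic_segment x y S -> S y.
Proof.
move=> [l [c [[l0 _ cy _] ->]]]; exists l => //=.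
by rewrite in_itv/= l0 lexx.
Qed.

Hypothesis Egeo : geodesic_space E.

(** A geodesic from [x] to [y] followed by one from [y] to [z] is again geodesic, because equality
    in the triangle inequality leaves no room for a shortcut. *)
Lemma between_geodesic_segment x y z : mdist x y + mdist y z = mdist x z ->
  exists2 S, geodesic_segment x z S & S y.
Proof.
move=> xyz.
have [l1 [c1 g1]] := Egeo x y; have [l2 [c2 g2]] := Egeo y z.
have e1 := geodesic_path_length g1; have e2 := geodesic_path_length g2.
case: (g1) => l10 c10 c1l _; case: (g2) => l20 c20 c2l _.
pose c t := if t <= l1 then c1 t else c2 (t - l1).
have c0 : c 0 = x by rewrite /c l10.
have cl1 : c l1 = y by rewrite /c lexx.
have cl : c (l1 + l2) = z.
  (* The endpoint falls into the first branch of [c] exactly when [l2 = 0], and then [y = z]. *)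
  rewrite /c gerDl; case: ifPn => [l20'|_]; last by rewrite addrC addKr.
  have l2E : l2 = 0 by apply/eqP; rewrite eq_le l20' l20.
  by rewrite l2E addr0 c1l -c20 -c2l l2E.
exists (c @` `[0, l1 + l2]%classic); last first.
  by exists l1 => //=; rewrite in_itv/= l10 lerDl.
exists (l1 + l2), c; split => //; split => //; first exact: addr_ge0.
suff ordered t t' : 0 <= t -> t <= t' -> t' <= l1 + l2 ->
    mdist (c t) (c t') = t' - t.
  move=> t t' /=; rewrite !in_itv/= => /andP[t0 tl] /andP[t'0 t'l].
  have [tt'|/ltW tt'] := leP t t'.
    by rewrite ordered// distrC ger0_norm// subr_ge0.
  by rewrite metric_sym ordered// ger0_norm// subr_ge0.
move=> t0 tt' t'l; rewrite /c.
have [tl1|tl1] := leP t l1; have [t'l1|t'l1] := leP t' l1.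
- by rewrite (geodesic_path_dist g1).
(* Parameters on either side of [l1]: the upper bound goes through [y], and the lower bound comes
   from the path [x], [c t], [c t'], [z], whose length is at least [l1 + l2]. *)
- have h1 : mdist x (c1 t) = t by rewrite -c10 (geodesic_path_dist g1) ?subr0.
  have h2 : mdist (c1 t) y = l1 - t by rewrite -c1l (geodesic_path_dist g1).
  have h3 : mdist y (c2 (t' - l1)) = t' - l1.
    by rewrite -c20 (geodesic_path_dist g2) ?subr0//; lra.
  have h4 : mdist (c2 (t' - l1)) z = l2 - (t' - l1).
    by rewrite -c2l (geodesic_path_dist g2)//; lra.
  have := metric_triangle (c1 t) y (c2 (t' - l1)).
  have := metric_triangle x (c1 t) z.
  have := metric_triangle (c1 t) (c2 (t' - l1)) z.
  by move=> *; apply/eqP; rewrite eq_le; apply/andP; split; lra.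
- lra.
- by rewrite (geodesic_path_dist g2); lra.
Qed.

Lemma geodesic_prolongation x y (e : R) : geodesic_extension_property E ->
  0 <= e -> exists2 z, mdist y z = e & mdist x z = mdist x y + e.
Proof.
move=> Eext e0; have [l [c xy]] := Egeo x y.
have lE := geodesic_path_length xy.
case: (xy) => l0 cx cy _.
have [|_ [g gE ->] cg] := Eext x y (c @` `[0, l]%classic); first by exists l, c.
have [s _ gs] : range g x.
  by apply: cg; exists 0 => //=; rewrite in_itv/= lexx l0.
have [t _ gt] : range g y.
  by apply: cg; exists l => //=; rewrite in_itv/= lexx l0.
have := gE s t; rewrite gs gt.
(* The line may run through [x] and [y] in either direction; [z] lies beyond [y] on the side away
   from [x]. *)
have [st|ts] := leP s t => dst.
  exists (g (t + e)); first by rewrite -gt gE opprD addNKr normrN ger0_norm.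
  by rewrite dst -gs gE distrC (distrC s) !ger0_norm; lra.
exists (g (t - e)); first by rewrite -gt gE opprB addrC subrK ger0_norm.
by rewrite dst -gs gE !ger0_norm; lra.
Qed.

(** Segments from [x] to [z] and to [w] share [y], so they end there or are nested; when nested,
    both endpoints lie on one segment at the same distance from [x]. *)
Lemma no_bifurcation_eq x y z w : no_bifurcating_geodesics E -> y <> x ->
  mdist x y + mdist y z = mdist x z -> mdist x y + mdist y w = mdist x w ->
  mdist x z = mdist x w -> z = w.
Proof.
move=> Enobif yx xyz xyw zw.
have [S Sz Sy] := between_geodesic_segment xyz.
have [T Tw Ty] := between_geodesic_segment xyw.
have [[<- <-]//|[ST|TS]] := Enobif _ _ _ _ _ Sz Tw _ yx Sy Ty.
- apply: (geodesic_segment_dist_inj Tw) zw.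
    by apply: ST; exact: geodesic_segment_right Sz.
  exact: geodesic_segment_right Tw.
- apply: (geodesic_segment_dist_inj Sz) zw.
    exact: geodesic_segment_right Sz.
  by apply: TS; exact: geodesic_segment_right Tw.
Qed.

End Geodesics.

Lemma continuous_mdist2 {R : realType} {E : metricType R} :
  continuous (fun z : E * E => mdist z.1 z.2 : R).
Proof.
move=> z; apply/cvgrPdist_le => e e0.
have e20 : 0 < e / 2 by rewrite divr_gt0.
exists (ball z.1 (e / 2), ball z.2 (e / 2)).
  by split; exact: nbhsx_ballx.
move=> w [/=]; rewrite !ballEmdist/= => h1 h2.
have := metric_triangle z.1 w.1 z.2; have := metric_triangle w.1 w.2 z.2.
have := metric_triangle w.1 z.1 w.2; have := metric_triangle z.1 z.2 w.2.
rewrite (metric_sym w.1 z.1) (metric_sym w.2 z.2) => *.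
by rewrite ler_norml; apply/andP; split; lra.
Qed.

(** * Well-posedness in terms of near-maximizers *)

Section MaxProblem.
Context {R : realType} {E : metricType R}.
Implicit Types (A X Y : Pcp E) (z w : E * E).

Lemma max_solution_exists A X : exists z, max_solution A X z.
Proof.
have [a Aa] := Pcp_nonempty A; have [x Xx] := Pcp_nonempty X.
have cAX : compact (A `*` X) := compact_setX (Pcp_compact A) (Pcp_compact X).
have [||] := @compact_EVT_max _ R (fun z => mdist z.1 z.2) _ _ cAX.
- by exists (a, x).
- by apply: continuous_subspaceT; exact: continuous_mdist2.
move=> z; rewrite inE => AXz zmax; exists z; split => //.
apply/eqP; rewrite eq_le; apply/andP; split.
  apply: ub_le_sup; last by exists z.
  by exists (mdist z.1 z.2) => _ [w AXw <-]; apply: zmax; rewrite inE.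
apply: ge_sup; first by exists (mdist z.1 z.2), z.
by move=> _ [w AXw <-]; apply: zmax; rewrite inE.
Qed.

Lemma mdist_le_mu A X z : (A `*` X) z -> mdist z.1 z.2 <= mu A X.
Proof.
move=> AXz; apply: ub_le_sup; last by exists z.
have [a Aa] := Pcp_nonempty A.
have [M HM] := compact_mdist_bounded a (Pcp_compact A).
have [N HN] := compact_mdist_bounded a (Pcp_compact X).
exists (M + N) => _ [w [Aw Xw] <-].
apply: le_trans (metric_triangle _ a _) _; rewrite metric_sym.
by apply: lerD; [apply: HM; exists w.1|apply: HN; exists w.2].
Qed.

(** Pairs are compared with each other rather than with a solution, so that the condition transfers
    to nearby sets. *)
Definition near_maximizers_within A X (e : R) := exists2 d : R, 0 < d &
  forall z w, (A `*` X) z -> (A `*` X) w ->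
    mu A X - d <= mdist z.1 z.2 -> mu A X - d <= mdist w.1 w.2 ->
    mdist z.1 w.1 < e /\ mdist z.2 w.2 < e.

Lemma near_maximizers_withinW A X (e e' : R) : e <= e' ->
  near_maximizers_within A X e -> near_maximizers_within A X e'.
Proof.
move=> ee' [d d0 dP]; exists d => // z w AXz AXw zd wd.
by have [? ?] := dP _ _ AXz AXw zd wd; split; apply: lt_le_trans ee'.
Qed.

(** Away from a neighborhood [U] of the solution the distance attains a maximum, which uniqueness
    keeps below [mu A X]; this gap provides [d]. *)
Lemma unique_near_maximizers A X z0 : max_solution A X z0 ->
  (forall z, max_solution A X z -> z = z0) ->
  forall e : R, 0 < e -> near_maximizers_within A X e.
Proof.
move=> [AXz0 _] uniq e e0.
pose U : set (E * E) := ball z0.1 (e / 2) `*` ball z0.2 (e / 2).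
have e20 : 0 < e / 2 by rewrite divr_gt0.
suff [d d0 dU] : exists2 d : R, 0 < d & forall z, (A `*` X) z ->
    mu A X - d <= mdist z.1 z.2 -> U z.
  exists d => // z w AXz AXw /(dU _ AXz)[zU1 zU2] /(dU _ AXw)[wU1 wU2].
  have := ball_splitr zU1 wU1; have := ball_splitr zU2 wU2.
  by rewrite !ballEmdist.
have [K0|K0] := pselect ((A `*` X) `\` U !=set0); last first.
  exists 1 => // z AXz _; apply: contrapT => Uz; apply: K0.
  by exists z.
(* Removing the interior of [U] instead of [U] leaves a closed, hence compact, set. *)
have cK : compact ((A `*` X) `\` interior U).
  have cAX : compact (A `*` X) := compact_setX (Pcp_compact A) (Pcp_compact X).
  rewrite setDE; apply: compact_closedI => //.
  exact/open_closedC/open_interior.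
have KK : (A `*` X) `\` U `<=` (A `*` X) `\` interior U.
  by move=> z [AXz nUz]; split => // /interior_subset.
have [||m] := @compact_EVT_max _ R (fun z => mdist z.1 z.2) _ _ cK.
- by case: K0 => z /KK; exists z.
- by apply: continuous_subspaceT; exact: continuous_mdist2.
rewrite inE => -[AXm nUm] mmax.
have mlt : mdist m.1 m.2 < mu A X.
  rewrite lt_neqAle mdist_le_mu// andbT; apply/eqP => mE; apply: nUm.
  rewrite (uniq m)//.
  by exists (ball z0.1 (e / 2), ball z0.2 (e / 2)) => //=; split;
    exact: nbhsx_ballx.
exists ((mu A X - mdist m.1 m.2) / 2); first by lra.
move=> z AXz zd; apply: contrapT => nUz.
have : mdist z.1 z.2 <= mdist m.1 m.2 by apply: mmax; rewrite inE; exact: KK.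
lra.
Qed.

(** A solution [z0] exists by compactness and is a near-maximizer for every [d]; other solutions and
    the tails of maximizing sequences are compared with it. *)
Lemma near_maximizers_well_posed A X :
  (forall e : R, 0 < e -> near_maximizers_within A X e) -> max_well_posed A X.
Proof.
move=> near_max; have [z0 [AXz0 z0E]] := max_solution_exists A X.
exists z0; split => //.
- move=> z [AXz zE].
  suff d0 (x y : E) : (forall e : R, 0 < e -> mdist x y < e) -> x = y.
    rewrite (surjective_pairing z) (surjective_pairing z0).
    by congr pair; apply: d0 => e /near_max[d d0 dP];
      have [] := dP _ _ AXz AXz0; rewrite ?zE ?z0E// gerBl ltW.
  move=> xy; apply: contrapT => /eqP; rewrite -mdist_gt0 => /xy.
  by rewrite ltxx.
move=> z [AXz zmu].
have near_z (e : R) : 0 < e -> \forall n \near \oo,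
    mdist z0.1 (z n).1 < e /\ mdist z0.2 (z n).2 < e.
  move=> /near_max[d d0 dP].
  have /cvgrPdist_lt/(_ _ d0) := zmu; apply: filterS => n.
  rewrite ltr_norml => /andP[_ zn]; apply: dP => //.
    by rewrite z0E gerBl ltW.
  lra.
split; apply/metricType_numDomainType.cvgrPdist_lt => e /near_z;
  by apply: filterS => n [].
Qed.

Lemma well_posedP A X : max_well_posed A X <->
  forall e : R, 0 < e -> near_maximizers_within A X e.
Proof.
split; last exact: near_maximizers_well_posed.
by move=> [z0 [z0s uniq _]]; exact: unique_near_maximizers z0s uniq.
Qed.

(** * Stability under Hausdorff perturbation and the G-delta property *)

Lemma hausdorff_approx X Y (d : R) y : mdist X Y < d -> Pcp_set Y y ->
  exists2 x, Pcp_set X x & mdist x y < d.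
Proof.
rewrite Pcp_mdistE /hausdorff_dist gt_max => /andP[_ YX] Yy.
have [x0 Xx0] := Pcp_nonempty X.
have yX := dist_le_sup (Pcp_compact Y) (Pcp_nonempty X) Yy.
have yd : dist y X < d by exact: le_lt_trans YX.
have yX0 : [set mdist y x | x in X] !=set0 by exists (mdist y x0), x0.
have [_ [x Xx <-] xy] := inf_lt yX0 yd.
by exists x => //; rewrite metric_sym.
Qed.

Lemma mu_le_hausdorff A X Y (d : R) : mdist X Y < d -> mu A Y <= mu A X + d.
Proof.
move=> XY; have [[a y] [[/= Aa Yy] <-]] := max_solution_exists A Y.
have [x Xx xy] := hausdorff_approx XY Yy.
apply: le_trans (metric_triangle a x y) _; rewrite lerD ?(ltW xy)//.
exact: (@mdist_le_mu A X (a, x)).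
Qed.

Lemma near_maximizers_stable A X (e : R) : 0 < e ->
  near_maximizers_within A X (e / 2) ->
  \forall Y \near X, near_maximizers_within A Y e.
Proof.
move=> e0 [d d0 dP]; apply/metricType_numDomainType.nbhs_mdistP.
(* Replacing [Y] by [X] costs [r] in [mu] and [r] in the distance of the pair, which with the slack
   [d / 2] stays within [d]. Moving both second components costs [2 * r], which with [e / 2] stays
   within [e]. *)
pose r := Num.min (d / 4) (e / 4).
have rd : r <= d / 4 by rewrite ge_min lexx.
have re : r <= e / 4 by rewrite ge_min lexx orbT.
exists r => [|Y /= XY]; first by rewrite /= lt_min !divr_gt0.
have muXY : mu A X <= mu A Y + r by apply: mu_le_hausdorff; rewrite metric_sym.
have approx z : (A `*` Y) z -> mu A Y - d / 2 <= mdist z.1 z.2 ->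
    exists x, [/\ (A `*` X) (z.1, x), mdist x z.2 < r
                & mu A X - d <= mdist z.1 x].
  move=> [Az Yz] zd; have [x Xx xz] := hausdorff_approx XY Yz.
  exists x; split => //.
  by have := metric_triangle z.1 x z.2; lra.
exists (d / 2); first by rewrite divr_gt0.
move=> z w AYz AYw /(approx _ AYz)[x [AXx xz dx]].
move=> /(approx _ AYw)[y [AXy yw dy]].
have /=[zw xy] := dP _ _ AXx AXy dx dy.
split; first lra.
have := metric_triangle z.2 x w.2; have := metric_triangle x y w.2.
by rewrite (metric_sym z.2 x); lra.
Qed.

Lemma Wmax_Gdelta A : Gdelta (Wmax A).
Proof.
exists (fun n => interior [set X | near_maximizers_within A X n.+1%:R^-1]).
  by move=> n; exact: open_interior.
apply/seteqP; split => [X /well_posedP WX n _|X WX].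
  by apply: near_maximizers_stable; [|apply: WX]; rewrite ?divr_gt0 ?invr_gt0.
apply/well_posedP => e e0.
have [n ne] : exists n, n.+1%:R^-1 <= e.
  exists (Num.truncn e^-1); rewrite -[leRHS]invrK lef_pV2 ?posrE ?invr_gt0//.
  by rewrite ltW// truncnS_gt.
by apply: near_maximizers_withinW ne _; exact: interior_subset (WX n I).
Qed.

(** * Density by adjoining one point *)

Lemma setU1_compact X (y : E) : compact (y |` X).
Proof. by apply: compactU; [exact: compact_set1|exact: Pcp_compact]. Qed.

Lemma setU1_nonempty X (y : E) : y |` X !=set0.
Proof. by exists y; left. Qed.

Definition Pcp_setU1 X (y : E) : Pcp E :=
  MkPcp (setU1_nonempty X y) (@setU1_compact X y).

Lemma hausdorff_setU1 X x (y : E) : Pcp_set X x ->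
  mdist X (Pcp_setU1 X y) <= mdist x y.
Proof.
move=> Xx.
have self (Z : set E) (w : E) : Z w -> dist w Z <= mdist x y.
  by move=> Zw; apply: le_trans (dist_le w Zw) _; rewrite mdistxx mdist_ge0.
rewrite Pcp_mdistE /hausdorff_dist ge_max; apply/andP.
split; apply: sup_dist_le.
- exact: Pcp_nonempty.
- by move=> w Xw; apply: self; right.
- exact: setU1_nonempty.
- move=> w [->|]; last exact: self.
  by rewrite metric_sym dist_le.
Qed.

Lemma Wmax_dense A : geodesic_space E -> no_bifurcating_geodesics E ->
  geodesic_extension_property E -> dense (Wmax A).
Proof.
move=> Egeo Enobif Eext O [X OX] oO.
have /metricType_numDomainType.nbhs_mdistP[r /= r0 rO] : nbhs X O.
  exact: open_nbhs_nbhs.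
have [[a0 x0] [[/= Aa0 Xx0] muE]] := max_solution_exists A X.
(* Half of [r] keeps the enlarged set strictly inside the ball, while [y] still differs from
   [x0]. *)
have e0 : 0 < r / 2 by rewrite divr_gt0.
have [y x0y a0y] := geodesic_prolongation Egeo a0 x0 Eext (ltW e0).
exists (Pcp_setU1 X y); split.
  apply: rO => /=; apply: le_lt_trans (hausdorff_setU1 y Xx0) _.
  by rewrite x0y; lra.
have lex0 a : Pcp_set A a -> mdist a x0 <= mu A X.
  by move=> Aa; exact: (@mdist_le_mu A X (a, x0)).
have AYa0 : (A `*` Pcp_setU1 X y) (a0, y) by split => //; left.
have ley z : (A `*` Pcp_setU1 X y) z -> mdist z.1 z.2 <= mdist a0 y.
  case: z => a w [/= Aa [->|Xw]]; rewrite a0y muE.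
    have := lex0 _ Aa; have := metric_triangle a x0 y; lra.
  have := @mdist_le_mu A X (a, w) (conj Aa Xw); rewrite /=; lra.
have muYE : mu A (Pcp_setU1 X y) = mdist a0 y.
  have [z [AYz zE]] := max_solution_exists A (Pcp_setU1 X y).
  by apply/eqP; rewrite eq_le -{1}zE ley//= (mdist_le_mu AYa0).
apply/well_posedP/unique_near_maximizers; first by split; [exact: AYa0|].
(* A pair from [A] and [X] reaches at most [mu A X], which is [r / 2] short of the new maximum. *)
move=> [a w] [[/= Aa] + awE]; rewrite muYE in awE; case=> [wy|Xw]; last first.
  exfalso; have := @mdist_le_mu A X (a, w) (conj Aa Xw); rewrite /=; lra.
rewrite wy in awE *; congr pair.
(* As [a] is at most [mu A X] from [x0] but [mu A X + r / 2] from [y], the triangle inequality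
   through [x0] is an equality, just as for [a0]. *)
have := lex0 _ Aa; have := metric_triangle a x0 y => ax0y aX.
apply: (no_bifurcation_eq Egeo (x := y) (y := x0)) => //.
- by apply/eqP; rewrite -mdist_gt0 x0y.
- rewrite !(metric_sym y) (metric_sym x0 a); lra.
- rewrite !(metric_sym y) (metric_sym x0 a0); lra.
- by rewrite !(metric_sym y).
Qed.

End MaxProblem.

Theorem theorem4p5 (R : realType) (E : metricType R)
  (Ecomplete : complete_metric E)
  (Egeodesic : geodesic_space E)
  (Enobif : no_bifurcating_geodesics E)
  (Eext : geodesic_extension_property E)
  (A : Pcp E) :
  dense (Wmax A) /\ Gdelta (Wmax A).
Proof. by split; [exact: Wmax_dense|exact: Wmax_Gdelta]. Qed.
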